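(* Let $n\ge1$ be an integer, let $0<\beta<\alpha<n$ be real numbers, and put $q_{n,\alpha,\beta}=(4n-4\alpha+2\beta)/\beta$. There exist constants $C_1,C_2>0$ and $p_0$, depending only on $n,\alpha,\beta$, and for each field $\mathbb{F}$ of prime order $|\mathbb{F}|\ge p_0$ a probability measure $\mu=\mu_{\mathbb{F}}$ on $\mathbb{F}^n$, such that: (1) $\mu(x)\le C_1|\mathbb{F}|^{-\alpha}$ for all $x\in\mathbb{F}^n$; (2) $|\widehat{\mu}(\xi)|\le C_2|\mathbb{F}|^{-\beta/2}$ for all $\xi\in\mathbb{F}^n$ with $\xi\neq0$; (3) for every $q$ with $1\le q<q_{n,\alpha,\beta}$ there are $\tau=\tau_{n,\alpha,\beta,q}>0$ and $c=c_{n,\alpha,\beta,q}>0$, not depending on $|\mathbb{F}|$, such that $R^*_{\mu}(2\to q)\ge c\,|\mathbb{F}|^{\tau}$ for all such $\mathbb{F}$.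
   Context: $\mathbb{F}$ is the finite field with $|\mathbb{F}|$ elements, $|\mathbb{F}|$ prime. A measure on $\mathbb{F}^n$ is a function $\mu:\mathbb{F}^n\to[0,\infty)$; it is a probability measure if $\sum_{x\in\mathbb{F}^n}\mu(x)=1$. For $x,\xi\in\mathbb{F}^n$ let $x\cdot\xi=x_1\xi_1+\cdots+x_n\xi_n \pmod{|\mathbb{F}|}$ and $e(-x\cdot\xi)=e^{-2\pi i\, x\cdot\xi/|\mathbb{F}|}$. For $f:\mathbb{F}^n\to\mathbb{C}$, $$\widehat{f\mu}(\xi)=\sum_{x\in\mathbb{F}^n}e(-x\cdot\xi)f(x)\mu(x),\qquad \widehat{\mu}(\xi)=\sum_{x\in\mathbb{F}^n}e(-x\cdot\xi)\mu(x).$$ Norms: $\|f\|_{L^q(\mathbb{F}^n)}=\big(\sum_x|f(x)|^q\big)^{1/q}$ and $\|f\|_{L^q(\mu)}=\big(\sum_x|f(x)|^q\mu(x)\big)^{1/q}$, with the usual (essential) supremum when $q=\infty$. For $1\le p,q\le\infty$, $R^*_\mu(p\to q)$ is the smallest constant $R$ such that $\|\widehat{f\mu}\|_{L^q(\mathbb{F}^n)}\le R\,\|f\|_{L^p(\mu)}$ for all complex functions $f$ on the support of $\mu$. *)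

(* Defs.v *)
From HB Require Import structures.
From mathcomp Require Import all_boot all_order all_algebra.
From mathcomp Require Import complex.
From mathcomp Require Import all_classical all_reals all_analysis.

Set Implicit Arguments.
Unset Strict Implicit.
Unset Printing Implicit Defensive.

Import Order.TTheory GRing.Theory Num.Theory.
Local Open Scope classical_set_scope.
Local Open Scope complex_scope.
Local Open Scope ring_scope.

(* Euler's formula for e^{2 pi i t}. *)
Definition expi2pi (R : realType) (t : R) : R[i] :=
  cos (2 * pi * t) +i* sin (2 * pi * t).

Definition dotF (p n : nat) (x xi : 'rV['F_p]_n) : 'F_p :=
  \sum_(j < n) x ord0 j * xi ord0 j.

(* The residue dotF x xi is lifted to its representative in {0, ..., p - 1};
   for p prime, any other representative gives the same phase. *)
Definition fourier (R : realType) (p n : nat) (g : 'rV['F_p]_n -> R[i])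
    (xi : 'rV['F_p]_n) : R[i] :=
  \sum_(x : 'rV['F_p]_n)
    expi2pi (- ((nat_of_ord (dotF x xi))%:R / p%:R)) * g x.

Definition modc (R : realType) (z : R[i]) : R := ComplexField.Normc.normc z.

Definition is_probability (R : realType) (T : finType) (mu : T -> R) : Prop :=
  (forall x, 0 <= mu x) /\ \sum_(x : T) mu x = 1.

(* The L^q norm for the measure with point masses w, 1 <= q <= +oo;
   the value at q = -oo is irrelevant. *)
Definition Lq_norm (R : realType) (T : finType) (w : T -> R) (q : \bar R)
    (f : T -> R[i]) : R :=
  match q with
  | r%:E => (\sum_(x : T) modc (f x) `^ r * w x) `^ r^-1
  | +oo%E => \big[Order.max/0]_(x : T | w x != 0) modc (f x)
  | -oo%E => 0
  end.

(* R^*_mu(r -> s): a function on the support of mu is given by any extension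
   to the whole space, the values off the support playing no role. *)
Definition restriction_const (R : realType) (p n : nat)
    (mu : 'rV['F_p]_n -> R) (r s : \bar R) : R :=
  inf [set K : R | forall f : 'rV['F_p]_n -> R[i],
         Lq_norm (fun=> 1) s (fourier (fun x => f x * (mu x)%:C))
           <= K * Lq_norm mu r f].

Definition q_threshold (R : realType) (n : nat) (alpha beta : R) : R :=
  (4 * n%:R - 4 * alpha + 2 * beta) / beta.

(* Main.v *)
Require Import Defs.
From HB Require Import structures.
From mathcomp Require Import all_boot all_order all_algebra.
From mathcomp Require Import complex.
From mathcomp Require Import all_classical all_reals all_analysis.
From mathcomp Require Import ring lra.

(** The measure is a convex combination of the uniform probability measures on
    F_p^n and on a box P,
      mu = (1 - p^(-alpha) |P|) p^(-n) + p^(-alpha) 1_P,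
    where P has about p^a points, a = alpha - beta / 2.

    Since alpha < n, the uniform part is at most p^(-alpha), so mu is at most
    2 p^(-alpha). The transform of the uniform part vanishes away from 0
    ([sum_phase_eq0]), so at a nonzero frequency the transform of mu is at most
    the mass p^(-alpha) |P| <= p^(-beta/2) of the second part
    ([fourier_bump_le]). The exponent a is the largest one for which this
    argument gives the decay p^(-beta/2).

    The test function for the restriction inequality is f = 1_P. Let N be
    the side of P and D the box whose side is about p / (8 n N). For x in P
    and xi in D the integer x . xi is at most p / 8, so no cancellation
    occurs in the sum of e(- x . xi) over x in P, and the transform of f mu
    is at least mu(P) / 2 on D. As ||f||_{L^2(mu)} = mu(P)^(1/2), the
    restriction constant is at least |D|^(1/q) mu(P)^(1/2) / 2
    ([restriction_const_ge_dual_pair]). Up to constants |D| is at least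
    p^(n - a) and mu(P) at least p^(-beta/2), giving a lower bound by a constant
    times p^tau with tau = (n - alpha + beta/2) / q - beta / 4, and tau > 0
    is exactly the condition q < (4 n - 4 alpha + 2 beta) / beta. *)

Set Implicit Arguments.
Unset Strict Implicit.
Unset Printing Implicit Defensive.

Import Order.TTheory GRing.Theory Num.Theory.
Local Open Scope complex_scope.
Local Open Scope ring_scope.

(** * The exponential and the modulus *)

Lemma expi2piD (R : realType) (s t : R) :
  expi2pi (s + t) = expi2pi s * expi2pi t.
Proof.
rewrite /expi2pi mulrDr cosD sinD /=; apply/eqP; rewrite eq_complex /=.
by apply/andP; split; apply/eqP; ring.
Qed.

Lemma expi2piN1 (R : realType) : expi2pi (- 1 : R) = 1.
Proof.
rewrite /expi2pi mulrN1 cosN sinN.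
by rewrite [2 * pi]mulr_natl cos2pi sin2pi oppr0.
Qed.

Lemma expi2piN_nat (R : realType) (k : nat) : expi2pi (- k%:R : R) = 1.
Proof.
elim: k => [|k IHk]; first by rewrite oppr0 /expi2pi mulr0 cos0 sin0.
by rewrite -natr1 opprD expi2piD IHk expi2piN1 mulr1.
Qed.

Lemma modc_expi2pi (R : realType) (t : R) : modc (expi2pi t) = 1.
Proof. by rewrite /modc /expi2pi /= cos2Dsin2 sqrtr1. Qed.

Lemma modcM (R : realType) (z w : R[i]) : modc (z * w) = modc z * modc w.
Proof. exact: ComplexField.Normc.normcM. Qed.

Lemma modc_real (R : realType) (r : R) : 0 <= r -> modc r%:C = r.
Proof. by move=> r0; rewrite /modc /= expr0n addr0 sqrtr_sqr ger0_norm. Qed.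

Lemma modc_ge0 (R : realType) (z : R[i]) : 0 <= modc z.
Proof. by case: z => a b; exact: sqrtr_ge0. Qed.

Lemma modc_sum_le (R : realType) (I : finType) (P : pred I) (F : I -> R[i]) :
  modc (\sum_(i | P i) F i) <= \sum_(i | P i) modc (F i).
Proof.
apply: (big_ind2 (fun (z : R[i]) r => modc z <= r)) => //.
  by rewrite [modc _]modc_real.
move=> z r w s zr ws; apply: le_trans (lerD zr ws).
exact: (@le_normcD R z w).
Qed.

Lemma Re_le_modc (R : realType) (z : R[i]) : complex.Re z <= modc z.
Proof.
case: z => a b; rewrite /modc /=; apply: le_trans (ler_norm a) _.
by rewrite -sqrtr_sqr ler_wsqrtr // lerDl sqr_ge0.
Qed.

Lemma Re_sum (R : realType) (I : finType) (P : pred I) (F : I -> R[i]) :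
  complex.Re (\sum_(i | P i) F i) = \sum_(i | P i) complex.Re (F i).
Proof. by apply: (big_morph (@complex.Re R)) => // -[a b] [c d]. Qed.

(** The doubled angle still lies within a quarter turn, so its cosine
    2 cos^2 - 1 is nonnegative, and cos is at least 1 / sqrt 2 > 1/2. *)
Lemma cos_ge_half (R : realType) (s : R) :
  0 <= s <= 8^-1 -> 2^-1 <= cos (2 * pi * - s).
Proof.
move=> /andP[s0 s8]; rewrite mulrN cosN; set t := 2 * pi * s.
have pi0 := pi_gt0 R.
have t0 : 0 <= t by rewrite /t !mulr_ge0 // ltW.
have t4 : t <= pi / 4 by rewrite /t; nra.
have ct : 0 <= cos t by apply: cos_ge0_pihalf; apply/andP; split; lra.
have : 0 <= cos (t + t) by apply: cos_ge0_pihalf; apply/andP; split; lra.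
rewrite cosD -!expr2 => c2t; have := cos2Dsin2 t => cs.
nra.
Qed.

Lemma ler_powRl (R : realType) (r x y : R) :
  0 <= r -> 0 <= x -> x <= y -> x `^ r <= y `^ r.
Proof.
by move=> r0 x0 xy; apply: ge0_ler_powR; rewrite ?nnegrE // (le_trans x0).
Qed.

Lemma mul_le_sqrt (R : realType) (a u S : R) :
  0 <= a -> 0 <= u -> a ^+ 2 * u <= S -> a * u <= Num.sqrt S * Num.sqrt u.
Proof.
move=> a0 u0 auS; have S0 : 0 <= S by rewrite (le_trans _ auS) ?mulr_ge0.
rewrite -sqrtrM // -[leLHS]ger0_norm ?mulr_ge0 // -sqrtr_sqr ler_wsqrtr //.
by rewrite exprMn [u ^+ 2]expr2 mulrA ler_wpM2r.
Qed.

(** * Characters of F_p^n *)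

Definition phase (R : realType) (p n : nat) (x xi : 'rV['F_p]_n) : R[i] :=
  expi2pi (- ((nat_of_ord (dotF x xi))%:R / p%:R)).

(** The phase does not depend on the representative of a residue. *)
Lemma expi2pi_Fp_nat (R : realType) (p k : nat) : prime p ->
  expi2pi (- ((nat_of_ord (k%:R : 'F_p))%:R / p%:R)) =
  expi2pi (- (k%:R / p%:R)) :> R[i].
Proof.
move=> pP; rewrite val_Fp_nat // {2}(divn_eq k p) natrD natrM mulrDl opprD.
rewrite mulfK ?expi2piD ?expi2piN_nat ?mul1r //.
by rewrite pnatr_eq0 -lt0n prime_gt0.
Qed.

Lemma dotFD (p n : nat) (x y xi : 'rV['F_p]_n) :
  dotF (x + y) xi = dotF x xi + dotF y xi.
Proof.
rewrite /dotF -big_split /=; apply: eq_bigr => j _.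
by rewrite !mxE mulrDl.
Qed.

Lemma phaseD (R : realType) (p n : nat) (x y xi : 'rV['F_p]_n) : prime p ->
  phase R (x + y) xi = phase R x xi * phase R y xi.
Proof.
move=> pP; rewrite /phase dotFD -expi2piD -opprD -mulrDl -natrD.
by rewrite -(expi2pi_Fp_nat _ (_ + _)) // natrD !natr_Zp.
Qed.

Lemma modc_phase (R : realType) (p n : nat) (x xi : 'rV['F_p]_n) :
  modc (phase R x xi) = 1.
Proof. exact: modc_expi2pi. Qed.

(** Orthogonality with the trivial character: translating by a vector y with
    y . xi = 1 multiplies the sum by e(-1), which differs from 1 because its
    imaginary part is -sin(2 pi / p); oddness of p keeps that sine positive. *)
Lemma sum_phase_eq0 (R : realType) (p n : nat) (xi : 'rV['F_p]_n) :
  prime p -> (2 < p)%N -> xi != 0 -> \sum_x phase R x xi = 0.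
Proof.
move=> pP p2 xi0.
have [j xij0] : exists j, xi ord0 j != 0.
  apply/existsP; apply: contraNT xi0 => /existsPn h; apply/eqP/rowP => j.
  by rewrite mxE; have := h j; rewrite negbK => /eqP.
pose y : 'rV['F_p]_n := \row_i (if i == j then (xi ord0 j)^-1 else 0).
have yxi : dotF y xi = 1.
  rewrite /dotF (bigD1 j) //= mxE eqxx mulVf // big1 ?addr0 // => i ij.
  by rewrite mxE (negPf ij) mul0r.
set S := \sum_x _.
have SE : S = S * phase R y xi.
  rewrite /S {1}(reindex_inj (@addIr _ y)) big_distrl /=.
  by apply: eq_bigr => x _; rewrite phaseD.
have p0 : (0 : R) < p%:R by rewrite ltr0n prime_gt0.
have y1 : phase R y xi != 1.
  rewrite /phase yxi (@expi2pi_Fp_nat R p 1) // /expi2pi eq_complex /=.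
  rewrite negb_and; apply/orP; right.
  rewrite mulrN sinN oppr_eq0 gt_eqF // sin_gt0_pi // div1r.
  have pi0 := pi_gt0 R.
  rewrite !mulr_gt0 ?invr_gt0 //= ltr_pdivrMr // mulrC ltr_pM2l //.
  by rewrite ltr_nat.
apply/eqP; have : S * (1 - phase R y xi) == 0.
  by rewrite mulrBr mulr1 -SE subrr.
by rewrite mulf_eq0 subr_eq0 [1 == _]eq_sym (negPf y1) orbF.
Qed.

(** * Lower bounds for the restriction constant *)

(** The infimum defining the restriction constant is over a nonempty set: the
    crude bound |f| mu <= ||f||_{L^2(mu)} mu^{1/2}, summed over x, controls
    the Fourier transform uniformly, and a sum over the finitely many
    frequencies then bounds its L^q norm. So the infimum is a true one (the
    empty set would give 0), and every test function bounds it from below. *)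
Lemma restriction_const_ge (R : realType) (p n : nat)
    (mu : 'rV['F_p]_n -> R) (q : R) (f : 'rV['F_p]_n -> R[i]) (c : R) :
  (forall x, 0 <= mu x) -> 1 <= q -> 0 < Lq_norm mu 2%:E f ->
  c * Lq_norm mu 2%:E f
    <= Lq_norm (fun=> 1) q%:E (fourier (fun x => f x * (mu x)%:C)) ->
  c <= restriction_const mu 2%:E q%:E.
Proof.
move=> mu0 q1 f0 cf; apply: lb_le_inf; last first.
  by move=> K /(_ f) fK; rewrite -(ler_pM2r f0) (le_trans cf).
have q0 : 0 < q by apply: lt_le_trans q1.
exists ((#|{: 'rV['F_p]_n}|%:R) `^ q^-1 * \sum_x Num.sqrt (mu x)) => g /=.
set L := (X in _ <= _ * X).
have L0 : 0 <= L by exact: powR_ge0.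
have gL x : modc (g x) * mu x <= L * Num.sqrt (mu x).
  have S0 y : 0 <= modc (g y) `^ 2 * mu y by rewrite mulr_ge0 ?powR_ge0.
  rewrite /L powR12_sqrt ?sumr_ge0 // mul_le_sqrt ?modc_ge0 //.
  rewrite (bigD1 x) //= powR_mulrn ?modc_ge0 // lerDl.
  exact: sumr_ge0.
have hatL xi : modc (fourier (fun x => g x * (mu x)%:C) xi)
    <= L * \sum_x Num.sqrt (mu x).
  apply: le_trans (modc_sum_le _ _) _; rewrite mulr_sumr; apply: ler_sum => x _.
  by rewrite !modcM modc_expi2pi mul1r modc_real.
have B0 : 0 <= L * \sum_x Num.sqrt (mu x).
  by rewrite mulr_ge0 ?sumr_ge0 // => x _; exact: sqrtr_ge0.
rewrite -mulrA [X in _ * X]mulrC; set B := L * _ in hatL B0 *.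
have -> : B = (B `^ q) `^ q^-1 by rewrite -powRrM mulfV ?powRr1 ?gt_eqF.
rewrite -powRM ?powR_ge0 ?ler0n //.
apply: ler_powRl; first by rewrite invr_ge0 ltW.
  by apply: sumr_ge0 => xi _; rewrite mulr1 powR_ge0.
rewrite mulr_natl -sumr_const; apply: ler_sum => xi _; rewrite mulr1.
by apply: ler_powRl; rewrite ?modc_ge0 ?(ltW q0).
Qed.

(** All the angles 2 pi x . xi / p are within an eighth of a turn of 0; here
    x . xi stands for its representative in {0, ..., p - 1}. *)
Definition dual_pair (p n : nat) (P D : {set 'rV['F_p]_n}) :=
  forall x xi, x \in P -> xi \in D -> (8 * dotF x xi <= p)%N.

(** Every term of the sum has real part at least 1/2: there is no
    cancellation. *)
Lemma dual_pair_sum_phase (R : realType) (p n : nat)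
    (P D : {set 'rV['F_p]_n}) (xi : 'rV['F_p]_n) :
  (0 < p)%N -> dual_pair P D -> xi \in D ->
  #|P|%:R / 2 <= modc (\sum_(x in P) phase R x xi).
Proof.
move=> p0 PD xiD; apply: le_trans (Re_le_modc _); rewrite Re_sum.
rewrite mulr_natl -sumr_const; apply: ler_sum => x xP; apply: cos_ge_half.
rewrite divr_ge0 ?ler0n //= ler_pdivrMr ?ltr0n // mulrC ler_pdivlMr //.
by rewrite -natrM ler_nat mulnC PD.
Qed.

(** The indicator f of P has norm (m |P|)^{1/2} in L^2(mu), while the transform
    of f mu is at least m |P| / 2 on D. *)
Lemma restriction_const_ge_dual_pair (R : realType) (p n : nat)
    (mu : 'rV['F_p]_n -> R) (P D : {set 'rV['F_p]_n}) (m q : R) :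
  (0 < p)%N -> (forall x, 0 <= mu x) -> 1 <= q -> 0 < m -> (0 < #|P|)%N ->
  (forall x, x \in P -> mu x = m) -> dual_pair P D ->
  #|D|%:R `^ q^-1 * (m * #|P|%:R) `^ 2^-1 / 2
    <= restriction_const mu 2%:E q%:E.
Proof.
move=> p0 mu0 q1 m0 P0 muP PD.
have q0 : 0 < q by apply: lt_le_trans q1.
pose f (x : 'rV['F_p]_n) : R[i] := ((x \in P)%:R : R)%:C.
have mP0 : 0 < m * #|P|%:R by rewrite mulr_gt0 ?ltr0n.
have fP x : modc (f x) = (x \in P)%:R by rewrite modc_real.
have fE : Lq_norm mu 2%:E f = (m * #|P|%:R) `^ 2^-1.
  rewrite /Lq_norm; congr (_ `^ _).
  rewrite mulr_natr -sumr_const [RHS]big_mkcond; apply: eq_bigr => x _.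
  rewrite fP; case: ifPn => xP; last by rewrite powR0 ?mul0r.
  by rewrite powR1 mul1r muP.
have hatE xi : fourier (fun x => f x * (mu x)%:C) xi =
    m%:C * \sum_(x in P) phase R x xi.
  rewrite mulr_sumr [RHS]big_mkcond; apply: eq_bigr => x _.
  rewrite /f; case: ifPn => xP; last by rewrite mul0r mulr0.
  by rewrite mul1r muP // mulrC.
apply: (@restriction_const_ge _ _ _ _ _ f) => //; first by rewrite fE powR_gt0.
rewrite fE; set Y := (m * _) `^ _; set B := m * (#|P|%:R / 2).
have YY : Y * Y = m * #|P|%:R.
  rewrite /Y -powRD; last by rewrite gt_eqF ?implybT.
  by rewrite (_ : 2^-1 + 2^-1 = 1 :> R) ?powRr1 ?ltW //; field.
have -> : #|D|%:R `^ q^-1 * Y / 2 * Y = #|D|%:R `^ q^-1 * B.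
  by rewrite /B [m * _]mulrA -YY; ring.
have B0 : 0 <= B by rewrite /B mulrA divr_ge0 // ltW.
have -> : B = (B `^ q) `^ q^-1 by rewrite -powRrM mulfV ?powRr1 ?gt_eqF.
rewrite -powRM ?powR_ge0 ?ler0n //.
apply: ler_powRl; first by rewrite invr_ge0 ltW.
  by rewrite mulr_ge0 ?powR_ge0.
rewrite mulr_natl -sumr_const big_mkcond; apply: ler_sum => xi _.
rewrite mulr1; case: ifPn => [xiD|_]; last by rewrite powR_ge0.
apply: ler_powRl; rewrite ?(ltW q0) //.
rewrite hatE modcM modc_real ?(ltW m0) // ler_pM2l //.
exact: (dual_pair_sum_phase R p0 PD xiD).
Qed.

(** * Dual boxes *)

Definition box (p n N : nat) : {set 'rV['F_p]_n} :=
  [set \row_j (nat_of_ord (k j))%:R | k : {ffun 'I_n -> 'I_N}].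

Lemma card_box (p n N : nat) :
  prime p -> (N <= p)%N -> #|box p n N| = (N ^ n)%N.
Proof.
move=> pP Np; rewrite card_imset ?card_ffun ?card_ord // => k l kl.
apply/ffunP => j; apply: val_inj => /=.
have kp (i : 'I_N) : (i < p)%N by apply: leq_trans Np.
have /rowP/(_ j) := kl; rewrite !mxE => /(congr1 (@nat_of_ord _)).
by rewrite !val_Fp_nat // !modn_small.
Qed.

(** The coordinates are small enough for x . xi, computed in the integers,
    to stay below p / 8, so no reduction modulo p takes place. *)
Lemma dual_pair_box (p n N M : nat) : prime p ->
  (8 * (n * (N * M)) <= p)%N -> dual_pair (box p n N) (box p n M.+1).
Proof.
move=> pP NMp _ _ /imsetP[k _ ->] /imsetP[l _ ->].
rewrite /dotF; under eq_bigr do rewrite !mxE -natrM.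
rewrite -natr_sum val_Fp_nat //; apply: leq_trans NMp.
rewrite leq_mul2l /=; apply: leq_trans (leq_mod _ _) _.
rewrite -[in leqRHS](card_ord n) -sum_nat_const leq_sum // => j _.
by rewrite leq_mul // ?(ltnW (ltn_ord _)) // -ltnS.
Qed.

(** * The uniform measure with a distinguished set *)

(** The uniform measure, scaled so as to leave room for the mass b |P| of b
    times the counting measure on P. *)
Definition bump (R : realType) (T : finType) (P : {set T}) (b : R) (x : T) :
    R :=
  (1 - b * #|P|%:R) / #|T|%:R + b * (x \in P)%:R.

Section Bump.
Context (R : realType) (T : finType) (P : {set T}) (b : R).
Hypotheses (b0 : 0 <= b) (bP : b * #|P|%:R <= 1).

Lemma bump_ge0 x : 0 <= bump P b x.
Proof. by rewrite addr_ge0 ?mulr_ge0 ?invr_ge0 ?subr_ge0. Qed.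

Lemma bump_le x : bump P b x <= #|T|%:R^-1 + b.
Proof.
apply: lerD; first by rewrite ler_piMl ?invr_ge0 // gerBl mulr_ge0.
by case: (x \in P); rewrite ?mulr1 ?mulr0.
Qed.

Lemma is_probability_bump : (0 < #|T|)%N -> is_probability (bump P b).
Proof.
move=> T0; split; first exact: bump_ge0.
rewrite big_split /= sumr_const -mulr_sumr -natr_sum -big_mkcond sum1_card.
by rewrite -[_ *+ _]mulr_natr divfK ?subrK // pnatr_eq0 -lt0n.
Qed.

End Bump.

(** Away from the zero frequency only the part on P contributes, and it is
    bounded by its total mass. *)
Lemma fourier_bump_le (R : realType) (p n : nat) (P : {set 'rV['F_p]_n})
    (b : R) (xi : 'rV['F_p]_n) :
  prime p -> (2 < p)%N -> 0 <= b -> xi != 0 ->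
  modc (fourier (fun x => (bump P b x)%:C) xi) <= b * #|P|%:R.
Proof.
move=> pP p2 b0 xi0.
have -> : fourier (fun x => (bump P b x)%:C) xi =
    b%:C * \sum_(x in P) phase R x xi.
  rewrite /fourier /bump; under eq_bigr do rewrite rmorphD mulrDr.
  rewrite big_split /= -mulr_suml (sum_phase_eq0 R pP p2 xi0) mul0r add0r.
  rewrite mulr_sumr [RHS]big_mkcond; apply: eq_bigr => x _.
  by case: ifP => _; rewrite ?mulr1 ?mulr0 // mulrC.
rewrite modcM modc_real // ler_wpM2l //; apply: le_trans (modc_sum_le _ _) _.
by under eq_bigr do rewrite modc_phase; rewrite sumr_const.
Qed.

(** * Boxes of prescribed size *)

(** The rounding makes a box of this side have between p^a / 2^n and p^a
    points when 0 <= a <= n. *)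
Definition side (R : realType) (n : nat) (a : R) (p : nat) : nat :=
  Num.truncn (p%:R `^ (a / n%:R)).

Section Side.
Context (R : realType) (n : nat) (a : R) (p : nat).
Hypotheses (n1 : (1 <= n)%N) (a0 : 0 <= a) (an : a <= n%:R) (pP : prime p).

Let y : R := p%:R `^ (a / n%:R).
Let N := side n a p.
Let M := (p %/ (8 * (n * N)))%N.

Let n0 : 0 < n%:R :> R. Proof. by rewrite ltr0n. Qed.
Let p0 : 0 < p%:R :> R. Proof. by rewrite ltr0n prime_gt0. Qed.
Let p1 : 1 <= p%:R :> R. Proof. by rewrite ler1n prime_gt0. Qed.

Let y1 : 1 <= y.
Proof. by rewrite -[leLHS](powRr0 p%:R) ler_powR // divr_ge0 // ltW. Qed.

Let y0 : 0 <= y. Proof. exact: le_trans y1. Qed.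

Let yn : y ^+ n = p%:R `^ a.
Proof. by rewrite -powR_mulrn // -powRrM divfK // gt_eqF. Qed.

Let Ny : N%:R <= y. Proof. by rewrite truncn_le. Qed.

Lemma side_gt0 : (0 < side n a p)%N.
Proof. by rewrite truncn_gt0. Qed.

Lemma side_le : (side n a p <= p)%N.
Proof.
rewrite -(ler_nat R) (le_trans Ny) // -[leRHS]powRr1 ?(ltW p0) //.
by rewrite ler_powR // ler_pdivrMr // mul1r.
Qed.

Lemma card_box_side_le : #|box p n (side n a p)|%:R <= p%:R `^ a.
Proof. by rewrite card_box ?side_le // natrX -yn lerXn2r ?nnegrE. Qed.

Lemma card_box_side_ge :
  p%:R `^ a / 2 ^+ n <= #|box p n (side n a p)|%:R.
Proof.
(* Rounding down a number y >= 1 loses at most half of it. *)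
rewrite card_box ?side_le // natrX -yn -expr_div_n.
apply: lerXn2r; rewrite ?nnegrE ?divr_ge0 // ler_pdivrMr //.
have N1 : 1 <= N%:R :> R by rewrite ler1n; exact: side_gt0.
have := truncnS_gt y; rewrite -[Num.truncn y]/N -natr1 => yN.
by rewrite -/N; lra.
Qed.

Lemma dual_side_le : (M.+1 <= p)%N.
Proof.
rewrite ltn_Pdiv ?prime_gt0 // (leq_trans (isT : (1 < 8)%N)) //.
by rewrite leq_pmulr // muln_gt0 n1 side_gt0.
Qed.

(** The dual side M + 1 exceeds p / (8 n N) >= p / (8 n y), where y^n = p^a;
    rounding up is harmless because the coordinates only reach M. *)
Lemma card_dual_box_ge :
  p%:R `^ (n%:R - a) * (((8 * n)%N%:R ^+ n)^-1) <= #|box p n M.+1|%:R.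
Proof.
rewrite card_box ?dual_side_le // natrX powRB.
  2: by rewrite (gt_eqF p0) implybT.
rewrite powR_mulrn ?(ltW p0) // -yn -!exprVn -!exprMn.
have y_gt0 : 0 < y by apply: lt_le_trans y1.
have k0 : 0 < (8 * n)%N%:R :> R by rewrite ltr0n muln_gt0 n1.
apply: lerXn2r; rewrite ?nnegrE // ?mulr_ge0 ?invr_ge0 ?(ltW p0) ?(ltW k0) //.
rewrite -mulrA -invfM ler_pdivrMr ?mulr_gt0 //.
have /ltnW : (p < M.+1 * (8 * (n * N)))%N.
  by rewrite ltn_ceil // !muln_gt0 n1 side_gt0.
rewrite -(ler_nat R) => /le_trans; apply.
by rewrite !natrM ler_wpM2l // [y * _]mulrC mulrA ler_wpM2l //.
Qed.

Lemma dual_pair_box_side : dual_pair (box p n (side n a p)) (box p n M.+1).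
Proof.
apply: dual_pair_box => //; rewrite !mulnA -[(8 * n * _)%N]mulnA mulnC.
exact: leq_trunc_div.
Qed.

End Side.

(** * Balancing decay against concentration *)

Theorem theorem1p4 (R : realType) (n : nat) (alpha beta : R) :
  (1 <= n)%N -> 0 < beta -> beta < alpha -> alpha < n%:R ->
  exists (C1 C2 : R) (p0 : nat) (mu : forall p : nat, 'rV['F_p]_n -> R),
    [/\ 0 < C1, 0 < C2,
      (forall p : nat, prime p -> (p0 <= p)%N ->
        [/\ is_probability (mu p),
            (forall x, mu p x <= C1 * p%:R `^ (- alpha)) &
            (forall xi, xi != 0 ->
               modc (fourier (fun x => (mu p x)%:C) xi)
                 <= C2 * p%:R `^ (- (beta / 2)))]) &
      (forall q : R, 1 <= q -> q < q_threshold n alpha beta ->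
        exists tau c : R, [/\ 0 < tau, 0 < c &
          forall p : nat, prime p -> (p0 <= p)%N ->
            c * p%:R `^ tau <= restriction_const (mu p) 2%:E q%:E])].
Proof.
move=> n1 beta0 ba an.
(* With |P| about p^a, the mass |P| p^(-alpha) carried by P is of the order of
   the required decay p^(-beta/2). *)
pose a := alpha - beta / 2.
have a0 : 0 <= a by rewrite /a; lra.
have a_n : a <= n%:R by rewrite /a; lra.
pose b (p : nat) : R := p%:R `^ (- alpha).
pose P p := box p n (side n a p).
have b0 p : 0 <= b p by exact: powR_ge0.
have bP p : prime p -> b p * #|P p|%:R <= p%:R `^ (- (beta / 2)).
  move=> pP; have Pa := card_box_side_le n1 a0 a_n pP.
  rewrite (_ : - (beta / 2) = - alpha + a); last by rewrite /a; ring.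
  rewrite powRD ?ler_wpM2l //.
  by rewrite pnatr_eq0 (gtn_eqF (prime_gt0 pP)) implybT.
have bP1 p : prime p -> b p * #|P p|%:R <= 1.
  move=> pP; apply: le_trans (bP p pP) _.
  rewrite -[leRHS](powRr0 p%:R) ler_powR ?ler1n ?prime_gt0 //; lra.
exists 2, 1, 3%N, (fun p => bump (P p) (b p)); split => //.
  move=> p pP p3; have Fn : #|{: 'rV['F_p]_n}| = (p ^ n)%N.
    by rewrite card_mx card_Fp // mul1n.
  split.
  - by apply: is_probability_bump; rewrite ?bP1 // Fn expn_gt0 prime_gt0.
  - move=> x; apply: le_trans (bump_le (P p) (b0 p) x) _.
    rewrite mulrDl mul1r lerD2r Fn natrX -powR_mulrn // -powRN ler_powR //.
      by rewrite ler1n prime_gt0.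
    by rewrite lerN2 ltW.
  - move=> xi xi0; rewrite mul1r; apply: le_trans (bP p pP).
    exact: fourier_bump_le.
move=> q q1 qt; have q0 : 0 < q by apply: lt_le_trans q1.
pose cD : R := ((8 * n)%N%:R ^+ n)^-1.
pose cP : R := (2 ^+ n)^-1.
have cD0 : 0 < cD by rewrite invr_gt0 exprn_gt0 // ltr0n muln_gt0.
have cP0 : 0 < cP by rewrite invr_gt0 exprn_gt0.
exists ((n%:R - a) / q - beta / 4), (cD `^ q^-1 * cP `^ 2^-1 / 2); split.
- move: qt; rewrite /q_threshold ltr_pdivlMr // => qt.
  rewrite subr_gt0 ltr_pdivlMr // /a; lra.
- by rewrite divr_gt0 // mulr_gt0 // powR_gt0.
move=> p pP p3.
have p0 : 0 < p%:R :> R by rewrite ltr0n prime_gt0.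
have bp0 : 0 < b p by rewrite powR_gt0.
pose D := box p n (p %/ (8 * (n * side n a p))).+1.
pose m : R := (1 - b p * #|P p|%:R) / #|{: 'rV['F_p]_n}|%:R + b p.
have bm : b p <= m by rewrite lerDr divr_ge0 ?subr_ge0 ?bP1.
have P0 : (0 < #|P p|)%N by rewrite card_box ?side_le // expn_gt0 side_gt0.
apply: le_trans (restriction_const_ge_dual_pair (m := m) (P := P p) (D := D)
  _ _ q1 _ P0 _ _); last 1 first.
- exact: dual_pair_box_side.
- have Dge : p%:R `^ (n%:R - a) * cD <= #|D|%:R by exact: card_dual_box_ge.
  have mPge : p%:R `^ (- (beta / 2)) * cP <= m * #|P p|%:R.
    have -> : - (beta / 2) = - alpha + a by rewrite /a; ring.
    rewrite powRD; last by rewrite (gt_eqF p0) implybT.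
    rewrite -mulrA ler_pM ?powR_ge0 ?mulr_ge0 ?powR_ge0 ?(ltW cP0) //.
    exact: card_box_side_ge.
  have -> : cD `^ q^-1 * cP `^ 2^-1 / 2 * p%:R `^ ((n%:R - a) / q - beta / 4) =
    (p%:R `^ (n%:R - a) * cD) `^ q^-1
      * (p%:R `^ (- (beta / 2)) * cP) `^ 2^-1 / 2.
    rewrite !powRM ?powR_ge0 ?(ltW cD0) ?(ltW cP0) // -!powRrM.
    rewrite powRD; last by rewrite (gt_eqF p0) implybT.
    rewrite (_ : - (beta / 2) / 2 = - (beta / 4)); last by field.
    by ring.
  rewrite ler_pM2r ?invr_gt0 // ler_pM ?powR_ge0 //.
    apply: ler_powRl Dge; first by rewrite invr_ge0 ltW.
    by rewrite mulr_ge0 ?powR_ge0 // ltW.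
  by apply: ler_powRl mPge; rewrite ?invr_ge0 // mulr_ge0 ?powR_ge0 // ltW.
- exact: prime_gt0.
- by move=> x; apply: bump_ge0; rewrite ?bP1.
- exact: lt_le_trans bm.
- by move=> x xP; rewrite /bump xP mulr1.
Qed.
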